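(* Let $S$ be a Hausdorff topological semigroup. Then $S$ is a topological paragroup if and only if $S$ is completely simple and, for each idempotent $e$ of $S$, the maximal subgroup $H_e$ of $S$ containing $e$, with the subspace topology, is a topological group.
   Context: All topological spaces are Hausdorff and all semigroups are nonempty. A topological semigroup is a topological space with a jointly continuous associative binary operation. A semigroup $S$ is simple if it contains no proper (nonempty) two-sided ideal. A simple semigroup $S$ is completely simple if the set $E=\{e\in S: ee=e\}$ contains a primitive idempotent, i.e. a minimal element of $E$ for the partial order $e\le f \iff ef=fe=e$. For an idempotent $e$, $H_e$ denotes the maximal subgroup of $S$ containing $e$ (the largest subsemigroup of $S$ that is a group with identity $e$); for completely simple $S$ one has $H_e=eSe$. For a group $H$, sets $X,Y$ and a map $\sigma:Y\times X\to H$, the Rees product $[X,H,Y]_\sigma$ is the set $X\times H\times Y$ with the operation $(x,h,y)\cdot(x',h',y')=(x,h\,\sigma(y,x')\,h',y')$. A topological paragroup is a topological semigroup that is topologically isomorphic (isomorphic via a homeomorphism) to a Rees product $[X,H,Y]_\sigma$ with the product topology, where $X,Y$ are topological spaces, $H$ is a topological group (multiplication and inversion continuous) and $\sigma:Y\times X\to H$ is continuous. *)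

(* Defs.v *)
From HB Require Import structures.
From mathcomp Require Import all_boot all_classical topology.

Set Implicit Arguments.
Unset Strict Implicit.
Unset Printing Implicit Defensive.

Local Open Scope classical_set_scope.
Local Open Scope group_scope.

#[short(type="preTopologicalSemigroupType")]
HB.structure Definition PreTopologicalSemigroup :=
  {S of Topological S & Semigroup S}.

HB.mixin Record PreTopologicalSemigroup_isTopologicalSemigroup S
    & PreTopologicalSemigroup S := {
  mulg_continuous : continuous (fun p : S * S => p.1 * p.2)
}.

#[short(type="topologicalSemigroupType")]
HB.structure Definition TopologicalSemigroup :=
  {S of PreTopologicalSemigroup S
      & PreTopologicalSemigroup_isTopologicalSemigroup S}.

HB.mixin Record TopologicalSemigroup_isTopologicalGroup H
    & Topological H & Group H := {
  invg_continuous : continuous (fun x : H => x^-1)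
}.

#[short(type="topologicalGroupType")]
HB.structure Definition TopologicalGroup :=
  {H of TopologicalSemigroup H & Group H
      & TopologicalSemigroup_isTopologicalGroup H}.

Section Semigroups.
Variable S : semigroupType.
Implicit Types (I G : set S) (e f x y : S).

Definition two_sided_ideal I :=
  I !=set0 /\ forall s x, I x -> I (s * x) /\ I (x * s).

Definition simple_semigroup :=
  [set: S] !=set0 /\ forall I, two_sided_ideal I -> I = [set: S].

Definition idempotents : set S := [set e | e * e = e].

Definition idempotent_le e f := e * f = e /\ f * e = e.

Definition primitive_idempotent e :=
  idempotents e /\ forall f, idempotents f -> idempotent_le f e -> f = e.

Definition completely_simple :=
  simple_semigroup /\ exists e, primitive_idempotent e.

Definition subgroup_with_id e G :=
  [/\ G e,
      forall x y, G x -> G y -> G (x * y),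
      forall x, G x -> e * x = x /\ x * e = x
    & forall x, G x -> exists2 y, G y & x * y = e /\ y * x = e].

(* The union of all subgroups with identity e; by maximal_subgroupP below it is
   itself the largest of them. *)
Definition maximal_subgroup e : set S :=
  [set x | exists2 G, subgroup_with_id e G & G x].

Lemma maximal_subgroupP e : idempotents e ->
  subgroup_with_id e (maximal_subgroup e) /\
  forall G, subgroup_with_id e G -> G `<=` maximal_subgroup e.
Proof.
move=> ee; split; last by move=> G sG x Gx; exists G.
pose U x := [/\ e * x = x, x * e = x &
  exists y, [/\ e * y = y, y * e = y, x * y = e & y * x = e]].
have sU : subgroup_with_id e U.
  split.
  - by split=> //; exists e.
  - move=> x y [ex xe [x' [ex' x'e xx' x'x]]] [ey ye [y' [ey' y'e yy' y'y]]].
    split; [by rewrite mulgA ex|by rewrite -mulgA ye|exists (y' * x')].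
    split; [by rewrite mulgA ey'|by rewrite -mulgA x'e| |].
    + by rewrite -mulgA (mulgA y) yy' ex' xx'.
    + by rewrite -mulgA (mulgA x') x'x ey y'y.
  - by move=> x [].
  - move=> x [ex xe [y [ey ye xy yx]]]; exists y => //.
    by split=> //; exists x.
suff -> : maximal_subgroup e = U by [].
apply/seteqP; split=> x; last by exists U.
move=> [G [_ _ Gid Ginv] Gx]; have [ex xe] := Gid x Gx.
split=> //; have [y /Gid[ey ye] [xy yx]] := Ginv x Gx.
by exists y.
Qed.

End Semigroups.

(* G is coerced to its type of elements, which carries the subspace topology;
   m and i are the operation of S restricted to G and the inversion of G. *)
Definition topological_subgroup (S : preTopologicalSemigroupType)
    (e : S) (G : set S) :=
  subgroup_with_id e G /\
  exists (m : G * G -> G) (i : G -> G),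
    [/\ forall p, val (m p) = val p.1 * val p.2,
        forall x, val x * val (i x) = e /\ val (i x) * val x = e,
        continuous m
      & continuous i].

Section ReesProduct.
Variables (X Y : topologicalType) (H : topologicalGroupType).

Definition rees_product (sigma : Y * X -> H) : Type := (X * H * Y)%type.

Variable sigma : Y * X -> H.

HB.instance Definition _ := Topological.copy (rees_product sigma) (X * H * Y)%type.

Definition rees_mul (p q : rees_product sigma) : rees_product sigma :=
  let: (x, h, y) := p in
  let: (x', h', y') := q in
  (x, h * sigma (y, x') * h', y').

Lemma rees_mulA : associative rees_mul.
Proof. by move=> [[x h] y] [[x' h'] y'] [[x'' h''] y'']; rewrite /= !mulgA. Qed.

HB.instance Definition _ := isSemigroup.Build (rees_product sigma) rees_mulA.

End ReesProduct.

Definition topologically_isomorphic (S T : preTopologicalSemigroupType) :=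
  exists (f : S -> T) (g : T -> S),
    [/\ {morph f : x y / x * y}, cancel f g, cancel g f,
        continuous f & continuous g].

Definition topological_paragroup (S : topologicalSemigroupType) :=
  exists (X Y : topologicalType) (H : topologicalGroupType)
         (sigma : Y * X -> H),
    [/\ hausdorff_space X, hausdorff_space Y, hausdorff_space H,
        continuous sigma
      & topologically_isomorphic S (rees_product sigma)].

(* Main.v *)
(** In a Rees product the idempotents are the triples (x, sigma(y,x)^-1, y), and
    inversion in the maximal subgroup at (x0,h0,y0) is the restriction of the
    globally defined map (x,h,y) |-> (x0, h0 h^-1 h0, y0), hence is continuous.

    Conversely, let e be a primitive idempotent of S and put X = E(Se),
    Y = E(eS), H = eSe = H_e and sigma(y,x) = yx.  With t(s) the inverse of ese
    in H_e, the map (x,h,y) |-> xhy has the inverse s |-> (s t(s), ese, t(s) s),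
    because s t(s) s = s; the continuity of t is the only place where the
    topological hypothesis on H_e is needed. *)

From HB Require Import structures.
Require Import Defs.
From mathcomp Require Import all_boot all_classical topology.

Set Implicit Arguments.
Unset Strict Implicit.
Unset Printing Implicit Defensive.

Local Open Scope classical_set_scope.
Local Open Scope group_scope.

(** * Continuity for products and subspaces *)

Lemma continuous_pair (T U V : topologicalType) (f : T -> U) (g : T -> V) :
  continuous f -> continuous g -> continuous (fun x => (f x, g x)).
Proof. by move=> cf cg x; apply: cvg_pair; [exact: cf|exact: cg]. Qed.

Lemma continuous_fst (T U : topologicalType) : continuous (@fst T U).
Proof. by move=> p; exact: cvg_fst. Qed.

Lemma continuous_snd (T U : topologicalType) : continuous (@snd T U).
Proof. by move=> p; exact: cvg_snd. Qed.

Lemma continuous_o (T U V : topologicalType) (f : T -> U) (g : U -> V) :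
  continuous f -> continuous g -> continuous (g \o f).
Proof. by move=> cf cg x; apply: continuous_comp; [exact: cf|exact: cg]. Qed.

Lemma continuousM (T : topologicalType) (S : topologicalSemigroupType)
    (f g : T -> S) :
  continuous f -> continuous g -> continuous (fun x => f x * g x).
Proof.
move=> cf cg.
exact: (continuous_o (continuous_pair cf cg) (@mulg_continuous S)).
Qed.

Lemma continuous_set_val (T : topologicalType) (A : set T) :
  continuous (\val : A -> T).
Proof. exact: initial_continuous. Qed.

Lemma continuous_to_set_type (T U : topologicalType) (A : set U) (f : T -> A) :
  continuous (fun x => \val (f x)) -> continuous f.
Proof. exact: continuous_comp_initial. Qed.

(** Preimages under [\val] of neighbourhoods in [T] are neighbourhoods in [A], so points inseparable
    in [A] are inseparable in [T]. *)
Lemma set_type_hausdorff (T : topologicalType) (A : set T) :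
  hausdorff_space T -> hausdorff_space A.
Proof.
move=> hT p q pq; apply: val_inj; apply: hT => P Q Pp Qq.
have [z [Pz Qz]] := pq _ _ (@continuous_set_val _ A p _ Pp)
  (@continuous_set_val _ A q _ Qq).
by exists (\val z).
Qed.

(** * Simple semigroups and the corner of a primitive idempotent *)

Section Semigroups.
Variable S : semigroupType.
Implicit Types e f x y s : S.

(** The set [S a S] is a two-sided ideal, hence all of [S]. *)
Lemma simple_semigroup_factor a s : simple_semigroup S ->
  exists p q, s = p * a * q.
Proof.
move=> [_ simpS].
pose I := [set x : S | exists p q, x = p * a * q].
have : two_sided_ideal I.
  split; first by exists (a * a * a), a, a.
  move=> x _ [p [q ->]]; split.
    by exists (x * p), q; rewrite !mulgA.
  by exists p, (q * x); rewrite !mulgA.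
by move=> /simpS IT; have : I s by rewrite IT.
Qed.

(* For a in eSe, simplicity gives e = u a v with u, v in eSe; then a v u and
   v u a are idempotents below e, hence equal to e. *)
Lemma corner_subgroup e : simple_semigroup S -> primitive_idempotent e ->
  subgroup_with_id e [set x | e * x = x /\ x * e = x].
Proof.
move=> simpS [ee primE]; have {}ee : e * e = e := ee.
split=> //.
- by move=> x y [ex xe] [ey ye]; rewrite /= mulgA ex -mulgA ye.
move=> a [ea ae]; have [p [q epq]] := simple_semigroup_factor a e simpS.
pose u := e * p * e; pose v := e * q * e.
have eu : e * u = u by rewrite /u !mulgA ee.
have ue : u * e = u by rewrite /u -mulgA ee.
have ev : e * v = v by rewrite /v !mulgA ee.
have ve : v * e = v by rewrite /v -mulgA ee.
have uav : u * a * v = e.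
  rewrite /u /v !mulgA -(mulgA _ e a) ea -(mulgA _ a e) ae.
  by rewrite -2!(mulgA e) -epq !ee.
clearbody u v.
have auv : a * v * u = e.
  apply: primE; last split; rewrite /idempotents /=.
  - by rewrite !mulgA -(mulgA _ u a) -(mulgA _ (u * a)) uav -(mulgA a) ve.
  - by rewrite -mulgA ue.
  - by rewrite !mulgA ea.
have vua : v * u * a = e.
  apply: primE; last split; rewrite /idempotents /=.
  - by rewrite !mulgA -(mulgA _ a v) -(mulgA v u (a * v)) (mulgA u) uav ve.
  - by rewrite -mulgA ae.
  - by rewrite !mulgA ev.
by exists (v * u); rewrite /= ?mulgA ?ev -?mulgA ?ue //; rewrite !mulgA.
Qed.

(* If s = p e q, then e q t is the inverse of e p e in eSe, so that
   s t s = p (e q t p e) q = p e q. *)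
Lemma corner_inverse_regular e s t : simple_semigroup S ->
  primitive_idempotent e -> e * t = t -> t * e = t ->
  e * s * e * t = e -> s * t * s = s.
Proof.
move=> simpS primE et te est.
have ee : e * e = e := primE.1.
have [p [q spq]] := simple_semigroup_factor e s simpS.
have [_ _ _ /(_ (e * p * e))] := corner_subgroup simpS primE.
case=> [|a [ea ae] [_ ap]]; first by split; rewrite ?mulgA ?ee // -mulgA ee.
have qta : e * q * t = a.
  rewrite -[RHS]ae -[in RHS]est spq !mulgA -(mulgA _ e t) et.
  by move: ap; rewrite !mulgA => ->.
have qtpe : e * q * t * p * e = e.
  by rewrite qta -{1}ae -[RHS]ap !mulgA.
have -> : s * t * s = p * (e * q * t * p * e) * q by rewrite spq !mulgA.
by rewrite qtpe spq.
Qed.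

(** If [z] is the inverse of [x] in the group, then [y = e y = z x y = z e = z]. This places an
    inverse given by a formula in the maximal subgroup. *)
Lemma maximal_subgroup_inv e x y : idempotents e -> maximal_subgroup e x ->
  e * y = y -> x * y = e -> maximal_subgroup e y.
Proof.
move=> ee ex ey xy; have [[_ _ Hid Hinv] _] := maximal_subgroupP ee.
have [z ez [_ zx]] := Hinv x ex.
by have -> : y = z by rewrite -ey -zx -mulgA xy (Hid z ez).2.
Qed.

End Semigroups.

Lemma completely_simple_iso (S T : semigroupType) (f : S -> T) (g : T -> S) :
  {morph f : x y / x * y} -> cancel f g -> cancel g f ->
  completely_simple T -> completely_simple S.
Proof.
move=> fM fK gK [[[t _] simpT] [e [ee primE]]].
have gM x y : g (x * y) = g x * g y by rewrite -{1}[x]gK -{1}[y]gK -fM fK.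
split; first split.
- by exists (g t).
- move=> I [[x Ix] idI]; apply/seteqP; split=> // s _.
  (* Ideals are pulled back along the inverse isomorphism, where simplicity of [T] applies. *)
  have : two_sided_ideal (g @^-1` I).
    split; first by exists (f x); rewrite /= fK.
    by move=> u v Iv; rewrite /= !gM; exact: idI.
  by move=> /simpT IT; rewrite -[s]fK; have : (g @^-1` I) (f s) by rewrite IT.
exists (g e); split; first by rewrite /idempotents /= -gM ee.
move=> h hh [he eh]; rewrite -[h]fK; congr g; apply: primE.
  by rewrite /idempotents /= -fM hh.
by split; rewrite -[e]gK -fM ?he ?eh.
Qed.

(** * Rees products over a topological group *)

Section ReesProduct.
Variables (X Y : topologicalType) (H : topologicalGroupType).
Variable sigma : Y * X -> H.
Notation R := (rees_product sigma).
Implicit Types e p q : R.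

Lemma rees_mulE p q :
  p * q = (p.1.1, p.1.2 * sigma (p.2, q.1.1) * q.1.2, q.2) :> R.
Proof. by case: p q => [[? ?] ?] [[? ?] ?]. Qed.

Lemma rees_idempotent e : e * e = e -> sigma (e.2, e.1.1) = e.1.2^-1.
Proof.
rewrite rees_mulE => /(congr1 (fun p : R => p.1.2)) /= hsh.
by apply: (mulgI e.1.2); apply: (mulIg e.1.2); rewrite hsh mulgV mul1g.
Qed.

Lemma rees_completely_simple : [set: R] !=set0 -> completely_simple R.
Proof.
move=> [[[x0 h0] y0] _]; split; first split.
- by exists (x0, h0, y0).
- move=> I [[p Ip] idI]; apply/seteqP; split=> // -[[x h] y] _.
  (* The factor [h1] cancels what [p] and the two sandwich entries contribute to the middle
     coordinate, so any triple lies in the ideal generated by [p]. *)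
  pose h1 := h * (sigma (y, p.1.1) * p.1.2 * sigma (p.2, x))^-1.
  have -> : (x, h, y) = ((x, h1, y) : R) * p * (x, 1, y).
    by rewrite !rees_mulE /= mulg1 -2!mulgA (mulgA (sigma _)) mulgVK.
  by apply: (idI _ _ _).2; apply: (idI _ _ _).1.
exists (x0, (sigma (y0, x0))^-1, y0); split.
  by rewrite /idempotents /= rees_mulE /= mulVg mul1g.
(* An idempotent below the chosen one has the same outer coordinates, and these determine its middle
   coordinate. *)
move=> [[x h] y] /rees_idempotent /= sE [].
by rewrite !rees_mulE /= => -[_ yE] [xE _]; rewrite xE yE sE invgK.
Qed.

Definition rees_inv e p : R := (e.1.1, e.1.2 * p.1.2^-1 * e.1.2, e.2).

(** The hypotheses give [p] the outer coordinates of [e], so every sandwich entry involved is the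
    inverse of the middle coordinate of [e], and the middle coordinates telescope. *)
Lemma rees_invP e p : e * e = e -> e * p = p -> p * e = p ->
  [/\ e * rees_inv e p = rees_inv e p, p * rees_inv e p = e
    & rees_inv e p * p = e].
Proof.
move=> /rees_idempotent sE; rewrite /rees_inv !rees_mulE /=.
case: e p sE => [[x h] y] [[x' h'] y'] /= sE [<- _] [_ <-]; rewrite sE.
split; congr (_, _, _).
- by rewrite mulgV mul1g.
- by rewrite !mulgA mulgVK mulgV mul1g.
- by rewrite mulgK mulgVK.
Qed.

Lemma continuous_rees_inv e : continuous (rees_inv e).
Proof.
(* The explicit types expose the Rees product as a nested product space. *)
apply: (@continuous_pair _ (X * H)%type Y); last by move=> p; exact: cvg_cst.
apply: continuous_pair; first by move=> p; exact: cvg_cst.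
apply: continuousM; last by move=> p; exact: cvg_cst.
apply: continuousM; first by move=> p; exact: cvg_cst.
apply: (continuous_o (f := fun p : R => p.1.2)); last exact: invg_continuous.
exact: (continuous_o (@continuous_fst _ _) (@continuous_snd _ _)).
Qed.

End ReesProduct.

(** * Maximal subgroups of a paragroup are topological groups *)

Section ReesIsomorphism.
Variable S : topologicalSemigroupType.
Variables (X Y : topologicalType) (H : topologicalGroupType).
Variable sigma : Y * X -> H.
Notation R := (rees_product sigma).
Variables (f : S -> R) (g : R -> S).
Hypotheses (fM : {morph f : x y / x * y}) (fK : cancel f g) (gK : cancel g f).
Hypotheses (cf : continuous f) (cg : continuous g).

Lemma rees_topological_subgroup (e : S) :
  idempotents e -> topological_subgroup e (maximal_subgroup e).
Proof.
move=> ee; pose G := maximal_subgroup e.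
have [sG _] := maximal_subgroupP ee; split=> //.
have [Ge GM Gid _] := sG.
(* Being defined on all of [S], [j] is continuous as a composite; inversion on [G] is its
   restriction. *)
pose j z := g (rees_inv (f e) (f z)).
have jP z : G z -> [/\ e * j z = j z, z * j z = e & j z * z = e].
  move=> /Gid[ez ze].
  have [] := @rees_invP _ _ _ _ (f e) (f z); rewrite -?fM ?ee ?ez ?ze //.
  move=> ej zj jz; split; apply: (can_inj fK); rewrite !fM gK //.
have Gj z : G z -> G (j z).
  by move=> Gz; have [ej zj _] := jP z Gz; exact: maximal_subgroup_inv zj.
pose m (p : G * G) : G := exist _ (\val p.1 * \val p.2)
  (mem_set (GM _ _ (set_valP p.1) (set_valP p.2))).
pose i (x : G) : G := exist _ (j (\val x)) (mem_set (Gj _ (set_valP x))).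
exists m, i; split=> //.
- by move=> x; have [] := jP _ (set_valP x).
- apply: continuous_to_set_type; apply: continuousM.
    exact: (continuous_o (@continuous_fst _ _) (@continuous_set_val _ _)).
  exact: (continuous_o (@continuous_snd _ _) (@continuous_set_val _ _)).
- apply: continuous_to_set_type.
  have cj : continuous j.
    apply: (continuous_o (g := g) _ cg).
    exact: (continuous_o cf (@continuous_rees_inv _ _ _ sigma (f e))).
  exact: (continuous_o (@continuous_set_val _ _) cj).
Qed.

End ReesIsomorphism.

(** * A topological subgroup as a topological group type *)

Section TopologicalSubgroup.
Variables (S : topologicalSemigroupType) (e : S) (G : set S).

(** The alias depends on the proof [tG], so that the group instances below can be built from it. *)
Definition topological_subgroup_type (tG : topological_subgroup e G) : Type :=
  G.

Variable tG : topological_subgroup e G.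
Notation H := (topological_subgroup_type tG).

HB.instance Definition _ := Topological.copy H G.

(** The operations are only asserted to exist, so [cid] selects them by choice. *)
Let H_mul : H * H -> H := projT1 (cid tG.2).
Let H_inv : H -> H := projT1 (cid (projT2 (cid tG.2))).
Let H_spec :
  [/\ forall p, \val (H_mul p : G) = \val (p.1 : G) * \val (p.2 : G),
      forall x, \val (x : G) * \val (H_inv x : G) = e /\
        \val (H_inv x : G) * \val (x : G) = e,
      continuous H_mul & continuous H_inv] :=
  projT2 (cid (projT2 (cid tG.2))).

Let H_valM x y : \val (H_mul (x, y) : G) = \val (x : G) * \val (y : G).
Proof. by have [-> _ _ _] := H_spec. Qed.

Let H_one : H := let: And4 Ge _ _ _ := tG.1 in exist _ e (mem_set Ge).

Let H_val1 : \val (H_one : G) = e.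
Proof. by rewrite /H_one; case: tG.1. Qed.

Let H_mulA : associative (fun x y => H_mul (x, y)).
Proof. by move=> x y z; apply: val_inj; rewrite !H_valM mulgA. Qed.

Let H_mul1 : left_id H_one (fun x y => H_mul (x, y)).
Proof.
move=> x; apply: val_inj; rewrite H_valM H_val1.
by have [_ _ Gid _] := tG.1; have [] := Gid _ (set_valP x).
Qed.

Let H_mulr1 : right_id H_one (fun x y => H_mul (x, y)).
Proof.
move=> x; apply: val_inj; rewrite H_valM H_val1.
by have [_ _ Gid _] := tG.1; have [] := Gid _ (set_valP x).
Qed.

Let H_mulV : left_inverse H_one H_inv (fun x y => H_mul (x, y)).
Proof.
move=> x; apply: val_inj; rewrite H_valM H_val1.
by have [_ HV _ _] := H_spec; have [] := HV x.
Qed.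

Let H_mulrV : right_inverse H_one H_inv (fun x y => H_mul (x, y)).
Proof.
move=> x; apply: val_inj; rewrite H_valM H_val1.
by have [_ HV _ _] := H_spec; have [] := HV x.
Qed.

HB.instance Definition _ :=
  isGroup.Build H H_mulA H_mul1 H_mulr1 H_mulV H_mulrV.

Let H_mul_continuous : continuous (fun p : H * H => p.1 * p.2).
Proof.
have [_ _ cm _] := H_spec.
suff -> : (fun p : H * H => p.1 * p.2) = H_mul by [].
by apply/funext => -[].
Qed.

HB.instance Definition _ :=
  PreTopologicalSemigroup_isTopologicalSemigroup.Build H H_mul_continuous.

Let H_inv_continuous : continuous (fun x : H => x^-1).
Proof. by have [_ _ _ ci] := H_spec. Qed.

HB.instance Definition _ :=
  TopologicalSemigroup_isTopologicalGroup.Build H H_inv_continuous.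

Lemma topological_subgroup_valM (x y : H) :
  \val (x * y : G) = \val (x : G) * \val (y : G).
Proof. exact: H_valM. Qed.

Lemma topological_subgroup_valV (x : H) :
  \val (x : G) * \val (x^-1 : G) = e /\ \val (x^-1 : G) * \val (x : G) = e.
Proof. by have [_ HV _ _] := H_spec; exact: HV. Qed.

End TopologicalSubgroup.

(** * Rees coordinates on a completely simple semigroup *)

Section ReesCoordinates.
Variables (S : topologicalSemigroupType) (e : S).
Hypotheses (simpS : simple_semigroup S) (primE : primitive_idempotent e).
Hypothesis tG : topological_subgroup e (maximal_subgroup e).

Let G := maximal_subgroup e.
Let H : topologicalGroupType := topological_subgroup_type tG.
(** As [e] is idempotent, [x * e = x] expresses membership in [Se]; dually for [Y] and [eS]. *)
Let X := [set x : S | x * x = x /\ x * e = x].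
Let Y := [set y : S | y * y = y /\ e * y = y].

Let ee : e * e = e. Proof. exact: primE.1. Qed.

Let corner_G x : e * x = x -> x * e = x -> G x.
Proof.
move=> ex xe; exists [set x | e * x = x /\ x * e = x] => //.
exact: corner_subgroup.
Qed.

Let G_id x : G x -> e * x = x /\ x * e = x.
Proof. by have [[_ _ Gid _] _] := tG; exact: Gid. Qed.

Let G_idempotent x : G x -> x * x = x -> x = e.
Proof.
move=> Gx xx; have [[_ _ _ Ginv] _] := tG; have [y _ [xy _]] := Ginv x Gx.
by have [_ xe] := G_id Gx; rewrite -xe -xy mulgA xx.
Qed.

(** The element [e x] is an idempotent of the group [G], hence its identity. With the dual [e_Y],
    this lets [e (x h y) e] collapse to [h]. *)
Let X_e x : X x -> e * x = e.
Proof.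
move=> [xx xe]; apply: G_idempotent.
  by apply: corner_G; [rewrite mulgA ee|rewrite -mulgA xe].
by rewrite mulgA -(mulgA e x e) xe -mulgA xx.
Qed.

Let e_Y y : Y y -> y * e = e.
Proof.
move=> [yy ey]; apply: G_idempotent.
  by apply: corner_G; [rewrite mulgA ey|rewrite -mulgA ee].
by rewrite mulgA -(mulgA y e y) ey yy.
Qed.

Let sandwich_G (q : Y * X) : G (\val q.1 * \val q.2).
Proof.
have [_ xe] := set_valP q.2; have [_ ey] := set_valP q.1.
by apply: corner_G; [rewrite mulgA ey|rewrite -mulgA xe].
Qed.

Let sigma (q : Y * X) : H :=
  exist _ (\val q.1 * \val q.2) (mem_set (sandwich_G q)).

Let sigma_continuous : continuous sigma.
Proof.
apply: (@continuous_to_set_type _ _ G); apply: continuousM.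
  exact: (continuous_o (@continuous_fst _ _) (@continuous_set_val _ _)).
exact: (continuous_o (@continuous_snd _ _) (@continuous_set_val _ _)).
Qed.

Let middle_G s : G (e * s * e).
Proof. by apply: corner_G; rewrite ?mulgA ?ee // -mulgA ee. Qed.

Let middle s : H := exist _ (e * s * e) (mem_set (middle_G s)).

Let t s : S := \val ((middle s)^-1 : G).

(** The inverse of [e s e] lies in [eSe], so it absorbs the adjacent [e] in both inverse laws. *)
Let tP s : [/\ e * t s = t s, t s * e = t s, e * s * t s = e & t s * s * e = e].
Proof.
have [et te] := G_id (set_valP ((middle s)^-1 : G)).
have [st ts] := topological_subgroup_valV (middle s).
split=> //; first by rewrite -[RHS]st /= -(mulgA (e * s)) et.
by rewrite -[RHS]ts /= !mulgA te.
Qed.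

Let middle_continuous : continuous middle.
Proof.
apply: (@continuous_to_set_type _ _ G).
apply: continuousM; last by move=> s; exact: cvg_cst.
by apply: continuousM; [move=> s; exact: cvg_cst|move=> s].
Qed.

Let t_continuous : continuous t.
Proof.
exact: (continuous_o (continuous_o middle_continuous (@invg_continuous H))
  (@continuous_set_val _ G)).
Qed.

Let regular s : s * t s * s = s.
Proof.
have [et te st _] := tP s; apply: (corner_inverse_regular simpS primE et te).
by rewrite -(mulgA (e * s)) et.
Qed.

(** Idempotence comes from [s t s = s]. *)
Let left_X s : X (s * t s).
Proof.
have [_ te _ _] := tP s.
by split; [rewrite mulgA regular|rewrite -mulgA te].
Qed.

Let right_Y s : Y (t s * s).
Proof.
have [et _ _ _] := tP s.
by split; [rewrite -mulgA (mulgA s) regular|rewrite mulgA et].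
Qed.

Let to_rees (s : S) : rees_product sigma :=
  (exist _ (s * t s) (mem_set (left_X s)), middle s,
   exist _ (t s * s) (mem_set (right_Y s))).

Let of_rees (p : rees_product sigma) : S :=
  \val p.1.1 * \val (p.1.2 : G) * \val p.2.

Let of_reesM : {morph of_rees : p q / p * q}.
Proof.
move=> p q; rewrite rees_mulE /of_rees /=.
by rewrite 2!topological_subgroup_valM /= !mulgA.
Qed.

(** In [s t (e s e) t s] both inner [e] are absorbed by [t]; then [s t s = s] applies twice. *)
Let to_reesK : cancel to_rees of_rees.
Proof.
move=> s; have [et te _ _] := tP s; rewrite /of_rees /= !mulgA.
by rewrite -(mulgA s) te -(mulgA _ e (t s)) et !regular.
Qed.

Let of_reesK : cancel of_rees to_rees.
Proof.
move=> [[x h] y]; pose s := of_rees (x, h, y).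
have [eh he] := G_id (set_valP (h : G)).
have [_ xe] := set_valP x; have [_ ey] := set_valP y.
have ex := X_e (set_valP x); have ye := e_Y (set_valP y).
have hE : middle s = h.
  by apply: val_inj; rewrite /= /s /of_rees /= !mulgA ex eh -mulgA ye he.
have [hV Vh] := topological_subgroup_valV h.
have [eV Ve] := G_id (set_valP (h^-1 : G)).
have tE : t s = \val (h^-1 : G) by rewrite /t hE.
(* With [t s] equal to the inverse of [h], [y e = e] gives [s t = x h h^-1 = x e = x], and dually
   [t s = y]. *)
rewrite -/s; congr (_, _, _) => //; apply: val_inj; rewrite /= tE /s /of_rees /=.
  by rewrite -eV mulgA -(mulgA _ _ e) ye -(mulgA _ _ e) he -mulgA hV xe.
by rewrite -Ve !mulgA -(mulgA _ e) ex Ve Vh ey.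
Qed.

Lemma completely_simple_paragroup : hausdorff_space S -> topological_paragroup S.
Proof.
move=> hS; exists X, Y, H, sigma; split.
- exact: set_type_hausdorff.
- exact: set_type_hausdorff.
- exact: (@set_type_hausdorff _ G).
- exact: sigma_continuous.
exists to_rees, of_rees; split.
(* Multiplicativity is inherited from the inverse map, where it is plain associativity. *)
- by move=> x y; rewrite -{1}[x]to_reesK -{1}[y]to_reesK -of_reesM of_reesK.
- exact: to_reesK.
- exact: of_reesK.
- apply: (@continuous_pair _ (X * H)%type Y).
    apply: continuous_pair; last exact: middle_continuous.
    by apply: continuous_to_set_type; apply: continuousM => // s.
  by apply: continuous_to_set_type; apply: continuousM => // s.
- have cX : continuous (fun p : rees_product sigma => p.1.1).
    exact: (continuous_o (@continuous_fst _ _) (@continuous_fst _ _)).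
  have cH : continuous (fun p : rees_product sigma => p.1.2).
    exact: (continuous_o (@continuous_fst _ _) (@continuous_snd _ _)).
  have cY : continuous (fun p : rees_product sigma => p.2).
    exact: continuous_snd.
  apply: continuousM; last exact: (continuous_o cY (@continuous_set_val _ Y)).
  apply: continuousM; first exact: (continuous_o cX (@continuous_set_val _ X)).
  exact: (continuous_o cH (@continuous_set_val _ G)).
Qed.

End ReesCoordinates.

Theorem theorem1 (S : topologicalSemigroupType)
    (S_nonempty : [set: S] !=set0) (S_hausdorff : hausdorff_space S) :
  topological_paragroup S <->
  completely_simple S /\
  (forall e : S, idempotents e ->
     topological_subgroup e (maximal_subgroup e)).
Proof.
split.
  move=> [X [Y [H [sigma [_ _ _ _ [f [g [fM fK gK cf cg]]]]]]]]; split.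
    apply: (completely_simple_iso fM fK gK); apply: rees_completely_simple.
    by case: S_nonempty => s _; exists (f s).
  exact: (rees_topological_subgroup fM fK gK cf cg).
move=> [[simpS [e primE]] tG].
exact: (completely_simple_paragroup simpS primE (tG e primE.1) S_hausdorff).
Qed.
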